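(* Let $Q$ be a finite quiver without cycles, and let $\mathfrak{n}_Q$ be the nilpotent Lie algebra obtained by $Q$. Then there exists an inner product $\langle\,,\rangle$ on $\mathfrak{n}_Q$ which satisfies the following three conditions: (i) $\langle\,,\rangle$ is an algebraic Ricci soliton satisfying $\mathrm{Ric}=-\mathrm{id}+D$, where $D\in\mathrm{Der}(\mathfrak{n}_Q)$ is a derivation which is diagonal with respect to the basis $\mathrm{Path}(Q)$; (ii) $\mathrm{Path}(Q)$ is an orthogonal basis with respect to $\langle\,,\rangle$; (iii) $\langle\,,\rangle$ is preserved by $\mathrm{Aut}(Q)$.
   Context: A quiver $Q=(V,E,s,t)$ consists of two sets $V$ (vertices), $E$ (arrows) and two maps $s,t:E\to V$ (source, target). It is finite if $V$ and $E$ are finite. A path of length $m\ge 1$ is a sequence $\alpha_1\alpha_2\cdots\alpha_m$ with $\alpha_i\in E$ and $t(\alpha_i)=s(\alpha_{i+1})$ for $i=1,\dots,m-1$; its source is $s(\alpha_1)$ and its target is $t(\alpha_m)$. (Vertices are not counted as paths.) A cycle is a path whose source and target coincide. $\mathrm{Path}(Q)$ is the set of all paths. The Lie algebra obtained by $Q$ is the real vector space $\mathfrak{n}_Q$ with basis $\mathrm{Path}(Q)$ and bracket $[x,y]=x\cdot y-y\cdot x$, where $\cdot$ is the bilinear product given on paths by $x\cdot y=xy$ (concatenation) if $xy$ is a path, and $x\cdot y=0$ otherwise. $\mathrm{Aut}(Q)$ is the group of bijections $f:E\to E$ such that for all $x,y\in E$: $t(x)=s(y)$ if and only if $t(f(x))=s(f(y))$.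 It acts on $\mathrm{Path}(Q)$ by $f(\alpha_1\cdots\alpha_m)=f(\alpha_1)\cdots f(\alpha_m)$, and by linear extension on $\mathfrak{n}_Q$; an inner product is preserved by $\mathrm{Aut}(Q)$ if each $f\in\mathrm{Aut}(Q)$ acts isometrically. For a Lie algebra $\mathfrak{g}$ with inner product $\langle\,,\rangle$, the Levi-Civita connection $\nabla:\mathfrak{g}\times\mathfrak{g}\to\mathfrak{g}$ is defined by $2\langle\nabla_XY,Z\rangle=\langle[X,Y],Z\rangle+\langle[Z,X],Y\rangle+\langle X,[Z,Y]\rangle$; the Riemannian curvature is $R(X,Y)Z=\nabla_X\nabla_YZ-\nabla_Y\nabla_XZ-\nabla_{[X,Y]}Z$; the Ricci operator is $\mathrm{Ric}(X)=\sum_i R(X,e_i)e_i$ for an orthonormal basis $\{e_i\}$. $(\mathfrak{g},\langle\,,\rangle)$ is an algebraic Ricci soliton if $\mathrm{Ric}=c\cdot\mathrm{id}+D$ for some $c\in\mathbb{R}$ and some $D\in\mathrm{Der}(\mathfrak{g})$, the set of derivations of $\mathfrak{g}$. *)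

(* Defs.v *)
From HB Require Import structures.
From mathcomp Require Import all_boot all_order all_fingroup all_algebra.
From mathcomp Require Import reals ring.

Set Implicit Arguments.
Unset Strict Implicit.
Unset Printing Implicit Defensive.

Import GRing.Theory.
Local Open Scope ring_scope.

HB.mixin Record isLieAlgebra (R : realType) (g : Type) of Vector R g := {
  lie : g -> g -> g;
  lie_linearl : forall y, linear (lie^~ y);
  lie_linearr : forall x, linear (lie x);
  liexx : forall x, lie x x = 0;
  lie_jacobi : forall x y z,
    lie x (lie y z) + lie y (lie z x) + lie z (lie x y) = 0
}.

#[short(type="lieAlgType")]
HB.structure Definition LieAlgebra (R : realType) :=
  {g of isLieAlgebra R g & Vector R g}.

Section MetricLieAlgebra.
Variables (R : realType) (g : lieAlgType R).

Definition derivation (D : 'End(g)) : Prop :=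
  forall X Y : g, D (lie X Y) = lie (D X) Y + lie X (D Y).

Variable ip : {dot g for idfun}.

Definition orthogonal_basis (e : seq g) : bool :=
  basis_of fullv e && pairwise_orthogonal ip e.

Definition orthonormal_basis (e : seq g) : bool :=
  basis_of fullv e && orthonormal ip e.

Definition levi_civita (nabla : g -> g -> g) : Prop :=
  forall X Y Z : g,
    2 * ip (nabla X Y) Z = ip (lie X Y) Z + ip (lie Z X) Y + ip X (lie Z Y).

Definition curvature (nabla : g -> g -> g) (X Y Z : g) : g :=
  nabla X (nabla Y Z) - nabla Y (nabla X Z) - nabla (lie X Y) Z.

(* [levi_civita] determines [nabla], and the trace below does not depend on
   the orthonormal basis, so at most one function is a Ricci operator. *)
Definition is_ricci (Ric : g -> g) : Prop :=
  exists2 nabla, levi_civita nabla &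
  exists2 e, orthonormal_basis e &
    forall X, Ric X = \sum_(v <- e) curvature nabla X v v.

Definition ricci_soliton_eq (c : R) (D : 'End(g)) : Prop :=
  derivation D /\ is_ricci (fun X => c *: X + D X).

Definition algebraic_ricci_soliton : Prop :=
  exists c D, ricci_soliton_eq c D.

End MetricLieAlgebra.

Record finQuiver := FinQuiver {
  vertex : finType;
  arrow : finType;
  src : arrow -> vertex;
  tgt : arrow -> vertex
}.

Section Quiver.
Variable Q : finQuiver.

Definition composable : rel (arrow Q) := [rel a b | tgt a == src b].

Definition is_path (p : seq (arrow Q)) : bool :=
  (p != [::]) && sorted composable p.

Definition is_cycle (p : seq (arrow Q)) : bool :=
  if p is a :: p' then is_path p && (src a == tgt (last a p')) else false.

Definition acyclic : Prop := forall p, ~~ is_cycle p.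

Record qpath := QPath { arrows :> seq (arrow Q); qpathP : is_path arrows }.

HB.instance Definition _ := [isSub for arrows].
HB.instance Definition _ := [Countable of qpath by <:].

(* Automorphisms act on the arrows only: [f] need not be induced by a map of
   vertices. *)
Definition quiver_aut : {set {perm arrow Q}} :=
  [set f : {perm arrow Q} |
    [forall x, forall y, (tgt x == src y) == (tgt (f x) == src (f y))]].

Lemma quiver_autP (f : {perm arrow Q}) :
  reflect (forall x y, tgt x = src y <-> tgt (f x) = src (f y))
          (f \in quiver_aut).
Proof.
rewrite inE; apply: (iffP idP) => [/forallP fA x y|fA].
  have /eqP exy := forallP (fA x) y.
  by split=> /eqP; [rewrite exy => /eqP | rewrite -exy => /eqP].
apply/forallP => x; apply/forallP => y; apply/eqP.
by apply/eqP/eqP; apply fA.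
Qed.

Lemma quiver_aut_group_set : group_set quiver_aut.
Proof.
apply/group_setP; split=> [|f h fA hA]; apply/quiver_autP => x y.
  by rewrite !perm1.
rewrite !permM (quiver_autP f fA x y); exact: (quiver_autP h hA).
Qed.

Canonical quiver_aut_group := Group quiver_aut_group_set.

Lemma map_is_path (f : {perm arrow Q}) (p : qpath) :
  f \in quiver_aut -> is_path (map f p).
Proof.
move=> /quiver_autP fA; case: p => -[//|a p] /andP[_ /=].
rewrite /is_path /= path_map; apply: sub_path => x y /= /eqP /fA /eqP //.
Qed.

Definition aut_path (f : {perm arrow Q}) (fA : f \in quiver_aut) (p : qpath) :
  qpath := QPath (map_is_path p fA).

End Quiver.

Record acyclicQuiver := AcyclicQuiver {
  acyclic_quiver :> finQuiver;
  acyclicP : acyclic acyclic_quiver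
}.

Section AcyclicQuiver.
Variable Q : acyclicQuiver.

Lemma is_path_uniq (p : seq (arrow Q)) : is_path p -> uniq p.
Proof.
move=> /andP[_]; elim: p => [//|a p IHp] ap.
rewrite cons_uniq (IHp (path_sorted ap)) andbT; apply/negP => ap_in.
have /= := ap; case/splitPr: ap_in => p1 p2; rewrite cat_path => /andP[ap1].
move=> /= /andP[/eqP lp1 _].
have /negP := acyclicP (a :: p1); apply.
by rewrite /= /is_path /= ap1 -lp1 eqxx.
Qed.

Lemma size_qpath (p : qpath Q) : (size p <= #|arrow Q|)%N.
Proof.
have /card_uniqP <- := is_path_uniq (qpathP p); exact: max_card.
Qed.

Definition bseq_of_qpath (p : qpath Q) : {bseq #|arrow Q| of arrow Q} :=
  Bseq (size_qpath p).

Definition qpath_of_bseq (s : {bseq #|arrow Q| of arrow Q}) :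
  option (qpath Q) := insub (s : seq (arrow Q)).

Lemma bseq_of_qpathK : pcancel bseq_of_qpath qpath_of_bseq.
Proof. by move=> p; rewrite /qpath_of_bseq /= valK. Qed.

HB.instance Definition _ : isFinite (qpath Q) := PCanIsFinite bseq_of_qpathK.

Variable R : realType.

(* Path(Q) is finite, so the vector space with basis Path(Q) is the space of
   all functions on it. *)
Definition nQ : Type := {ffun qpath Q -> R^o}.

HB.instance Definition _ := Vector.on nQ.

Definition path_vec (p : qpath Q) : nQ := [ffun q => (q == p)%:R].

Definition path_basis : seq nQ := [seq path_vec p | p : qpath Q].

Definition concat (p q : qpath Q) : nQ :=
  if insub (val p ++ val q) is Some r then path_vec r else 0.

Definition path_mul (x y : nQ) : nQ :=
  \sum_p \sum_q (x p * y q) *: concat p q.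

Definition path_lie (x y : nQ) : nQ := path_mul x y - path_mul y x.

Lemma nQ_path_vec (x : nQ) : x = \sum_p x p *: path_vec p.
Proof.
apply/ffunP => q; rewrite sum_ffunE (bigD1 q) //= !ffunE eqxx.
rewrite big1 ?addr0 => [|p pq]; first by rewrite [RHS]mulr1.
by rewrite !ffunE eq_sym (negPf pq) scaler0.
Qed.

Lemma path_mul_linearl y : linear (path_mul^~ y).
Proof.
move=> a u v; rewrite /path_mul scaler_sumr -big_split /=.
apply: eq_bigr => p _; rewrite scaler_sumr -big_split /=.
apply: eq_bigr => q _; rewrite !ffunE mulrDl scalerDl scalerA.
by rewrite mulrA.
Qed.

Lemma path_mul_linearr x : linear (path_mul x).
Proof.
move=> a u v; rewrite /path_mul scaler_sumr -big_split /=.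
apply: eq_bigr => p _; rewrite scaler_sumr -big_split /=.
apply: eq_bigr => q _; rewrite !ffunE mulrDr scalerDl scalerA.
by rewrite mulrCA.
Qed.

Lemma path_lie_linearl y : linear (path_lie^~ y).
Proof.
move=> a u v; rewrite /path_lie path_mul_linearl path_mul_linearr.
by rewrite scalerBr opprD addrACA.
Qed.

Lemma path_lie_linearr x : linear (path_lie x).
Proof.
move=> a u v; rewrite /path_lie path_mul_linearl path_mul_linearr.
by rewrite scalerBr opprD addrACA.
Qed.

Let seq_vec (s : seq (arrow Q)) : nQ :=
  if insub s is Some r then path_vec r else 0.

Let seq_vecE (p : qpath Q) : seq_vec p = path_vec p.
Proof.
by rewrite /seq_vec; case: insubP => [q _ /val_inj -> //|/negP[]]; case: p.
Qed.

Let seq_vecN s : ~~ is_path s -> seq_vec s = 0.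
Proof. by rewrite /seq_vec => ns; case: insubP => // q qs; rewrite qs in ns. Qed.

Let mul_path_vec p q : path_mul (path_vec p) (path_vec q) = concat p q.
Proof.
rewrite /path_mul (bigD1 p) //= (bigD1 q) //= !ffunE !eqxx mulr1 scale1r.
rewrite big1 ?addr0 => [|r rq]; last first.
  by rewrite !ffunE (negPf rq) mulr0 scale0r.
rewrite big1 ?addr0 // => r rp; apply: big1 => t _.
by rewrite !ffunE (negPf rp) mul0r scale0r.
Qed.

Let is_path_cat (s t : seq (arrow Q)) :
  s != [::] -> t != [::] -> is_path (s ++ t) -> is_path s && is_path t.
Proof.
case: s t => [//|a s] [//|b t] _ _; rewrite /is_path /= cat_path /=.
by move=> /and3P[-> _ ->].
Qed.

Let mul_seq_vec s t : s != [::] -> t != [::] ->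
  path_mul (seq_vec s) (seq_vec t) = seq_vec (s ++ t).
Proof.
have zl x : path_mul 0 x = 0.
  by rewrite /path_mul !big1 // => p _; apply: big1 => q _;
     rewrite ffunE mul0r scale0r.
have zr x : path_mul x 0 = 0.
  by rewrite /path_mul !big1 // => p _; apply: big1 => q _;
     rewrite ffunE mulr0 scale0r.
move=> s0 t0; have /contra h := is_path_cat s0 t0.
have [ps|ns] := boolP (is_path s); last first.
  by rewrite !(seq_vecN ns, seq_vecN (h _)) ?zl // negb_and ns.
have [pt|nt] := boolP (is_path t); last first.
  by rewrite !(seq_vecN nt, seq_vecN (h _)) ?zr // negb_and nt orbT.
by have := mul_path_vec (QPath ps) (QPath pt); rewrite -!seq_vecE.
Qed.

Let path_ind (P : nQ -> Prop) :
  (forall a x y, P x -> P y -> P (a *: x + y)) -> P 0 ->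
  (forall p, P (path_vec p)) -> forall x, P x.
Proof.
move=> PD P0 Pv x; rewrite (nQ_path_vec x); apply: big_rec => // p y _.
exact: PD.
Qed.

Lemma path_mulA : associative path_mul.
Proof.
have zl x : path_mul 0 x = 0.
  by have := path_mul_linearl x (-1) 0 0; rewrite !scaleN1r !addNr.
have zr x : path_mul x 0 = 0.
  by have := path_mul_linearr x (-1) 0 0; rewrite !scaleN1r !addNr.
move=> x y z; elim/path_ind: x => [a x x' Hx Hx'||p].
- by rewrite !path_mul_linearl Hx Hx'.
- by rewrite !zl.
elim/path_ind: y => [a y y' Hy Hy'||q].
- by rewrite !(path_mul_linearl, path_mul_linearr) Hy Hy'.
- by rewrite !(zl, zr).
elim/path_ind: z => [a z z' Hz Hz'||r].
- by rewrite !path_mul_linearr Hz Hz'.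
- by rewrite !zr.
have n0 (u : qpath Q) : arrows u != [::] by case/andP: (qpathP u).
have c0 (u v : qpath Q) : arrows u ++ arrows v != [::].
  by move: (n0 u); case: (arrows u).
by rewrite -!seq_vecE !mul_seq_vec // catA.
Qed.

Lemma path_liexx x : path_lie x x = 0.
Proof. exact: subrr. Qed.

Lemma path_lie_jacobi x y z :
  path_lie x (path_lie y z) + path_lie y (path_lie z x)
  + path_lie z (path_lie x y) = 0.
Proof.
have mBl u v w : path_mul (u - v) w = path_mul u w - path_mul v w.
  by have := path_mul_linearl w (-1) v u; rewrite !scaleN1r ![- _ + _]addrC.
have mBr u v w : path_mul w (u - v) = path_mul w u - path_mul w v.
  by have := path_mul_linearr w (-1) v u; rewrite !scaleN1r ![- _ + _]addrC.
rewrite /path_lie !(mBl, mBr) -!path_mulA.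
set A := path_mul x (path_mul y z); set B := path_mul x (path_mul z y).
set C := path_mul y (path_mul z x); set D := path_mul y (path_mul x z).
set E := path_mul z (path_mul x y); set F := path_mul z (path_mul y x).
by apply/ffunP => p; rewrite !ffunE; ring.
Qed.

HB.instance Definition _ := isLieAlgebra.Build R nQ
  path_lie_linearl path_lie_linearr path_liexx path_lie_jacobi.

Definition diagonal (D : 'End(nQ)) : Prop :=
  exists d : qpath Q -> R, forall p, D (path_vec p) = d p *: path_vec p.

Definition aut_act (f : {perm arrow Q}) (fA : f \in quiver_aut Q) (x : nQ) :
  nQ := \sum_p x p *: path_vec (aut_path fA p).

Definition preserved_by_aut (ip : {dot nQ for idfun}) : Prop :=
  forall (f : {perm arrow Q}) (fA : f \in quiver_aut Q),
    isometry ip ip (aut_act fA).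

End AcyclicQuiver.

(* Main.v *)
Require Import Defs.
From HB Require Import structures.
From mathcomp Require Import all_boot all_order all_fingroup all_algebra.
From mathcomp Require Import reals ring.

(* Make [Path(Q)] orthogonal with [<p, p>] the product, over the inner vertices
   [v] of [p], of [k v = 2 / (1 + indeg v + outdeg v)], where [indeg v] and
   [outdeg v] count the paths ending and starting at [v].  Then
   [<pq, pq> = k v <p, p> <q, q>] when [p] ends and [q] starts at [v].  Since
   the bracket of two paths is, up to sign, a path or zero, and a path and one
   of the factors in a splitting determine the other factor, [Ric] is diagonal:
     [Ric p = 1/2 (\sum_(v inner to p) k v - k t * outdeg t - k s * indeg s) p]
   for [p] from [s] to [t].  The eigenvalues of [1 + Ric] are additive under
   concatenation through [v] if and only if
   [k v * (1 + indeg v + outdeg v) = 2], so [1 + Ric] is a derivation.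
   An automorphism of [Q] preserves [indeg] and [outdeg] at inner vertices of
   paths, hence the metric. *)

Set Implicit Arguments.
Unset Strict Implicit.
Unset Printing Implicit Defensive.

Import Order.TTheory GRing.Theory Num.Theory.
Local Open Scope ring_scope.

(** * Bilinearity and antisymmetry of the bracket *)

HB.instance Definition _ (R : realType) (g : lieAlgType R) :=
  bilinear_isBilinear.Build R g g g *:%R *:%R (@lie R g)
    (@lie_linearl R g, @lie_linearr R g).

Section LieAlgebra.
Variables (R : realType) (g : lieAlgType R).
Implicit Types x y z : g.

Lemma lieDl x y z : lie (x + y) z = lie x z + lie y z.
Proof. exact: linearDl. Qed.

Lemma lieDr x y z : lie x (y + z) = lie x y + lie x z.
Proof. exact: linearDr. Qed.

Lemma lie0r x : lie x 0 = 0.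
Proof. exact: linear0r. Qed.

Lemma lieZl a x y : lie (a *: x) y = a *: lie x y.
Proof. exact: linearZl_LR. Qed.

Lemma lieZr a x y : lie x (a *: y) = a *: lie x y.
Proof. exact: linearZr_LR. Qed.

Lemma lie_suml I r (P : pred I) (F : I -> g) z :
  lie (\sum_(i <- r | P i) F i) z = \sum_(i <- r | P i) lie (F i) z.
Proof. exact: linear_sumlz. Qed.

Lemma lieC x y : lie x y = - lie y x.
Proof.
apply/eqP; rewrite -addr_eq0; have := liexx (x + y).
by rewrite lieDl !lieDr !liexx add0r addr0 => ->.
Qed.

End LieAlgebra.

(** * Calculus with a real inner product *)

Section DotProduct.
Variables (R : realType) (g : lieAlgType R) (ip : {dot g for idfun}).

Lemma dotC x y : ip x y = ip y x.
Proof. by rewrite hermC mul1r. Qed.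

Lemma dot0r x : ip x 0 = 0.
Proof. exact: linear0r. Qed.

Lemma dot0l x : ip 0 x = 0.
Proof. exact: linear0l. Qed.

Lemma dotDl x y z : ip (x + y) z = ip x z + ip y z.
Proof. exact: linearDl. Qed.

Lemma dotNl x z : ip (- x) z = - ip x z.
Proof. exact: linearNl. Qed.

Lemma dotZl a x z : ip (a *: x) z = a * ip x z.
Proof. exact: linearZl_LR. Qed.

Lemma dotZr a x z : ip x (a *: z) = a * ip x z.
Proof. by rewrite dotC dotZl dotC. Qed.

Lemma dot_suml I r (P : pred I) (F : I -> g) z :
  ip (\sum_(i <- r | P i) F i) z = \sum_(i <- r | P i) ip (F i) z.
Proof. exact: linear_sumlz. Qed.

Lemma dot_sumr I r (P : pred I) (F : I -> g) z :
  ip z (\sum_(i <- r | P i) F i) = \sum_(i <- r | P i) ip z (F i).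
Proof. by rewrite dotC dot_suml; apply: eq_bigr => i _; rewrite dotC. Qed.

Lemma dot_inj x y : (forall z, ip x z = ip y z) -> x = y.
Proof.
move=> xy; apply/eqP; rewrite -subr_eq0; apply/negPn/negP => /neq0_dnorm_gt0.
by move=> /(_ _ ip); rewrite dotDl dotNl xy subrr ltxx.
Qed.

End DotProduct.

(** * The Levi-Civita connection and the Ricci form in an orthonormal frame *)

Section RicciFormula.
Variables (R : realType) (g : lieAlgType R) (ip : {dot g for idfun}).
Variables (I : finType) (e : I -> g).
Hypothesis e_exp : forall x, x = \sum_i ip x (e i) *: e i.

Lemma parseval x y : ip x y = \sum_i ip x (e i) * ip y (e i).
Proof.
rewrite {1}(e_exp x) dot_suml; apply: eq_bigr => i _.
by rewrite dotZl (dotC ip y).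
Qed.

Lemma dot_lie_expl x y z :
  ip (lie x y) z = \sum_i ip x (e i) * ip (lie (e i) y) z.
Proof.
rewrite {1}(e_exp x) lie_suml dot_suml; apply: eq_bigr => i _.
by rewrite lieZl dotZl.
Qed.

(** The defining identity of the connection prescribes the coordinates of [nabla x y] in the frame;
    taking the vector with these coordinates gives existence. *)
Definition koszul (x y : g) : g :=
  \sum_i (2^-1 * (ip (lie x y) (e i) + ip (lie (e i) x) y
                  + ip x (lie (e i) y))) *: e i.

Lemma koszulP : levi_civita ip koszul.
Proof.
move=> x y z; rewrite dot_suml mulr_sumr.
rewrite [ip (lie x y) z]parseval [ip (lie z x) y]dot_lie_expl (dotC ip x).
rewrite [ip (lie z y) x]dot_lie_expl -!big_split; apply: eq_bigr => i _ /=.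
by rewrite dotZl (dotC ip (e i)) (dotC ip x); field.
Qed.

Variable nabla : g -> g -> g.
Hypothesis nablaP : levi_civita ip nabla.

Lemma nablaE x y z :
  ip (nabla x y) z =
  2^-1 * (ip (lie x y) z + ip (lie z x) y + ip (lie z y) x).
Proof. by rewrite (dotC ip _ x) -nablaP mulrA mulVf ?mul1r ?pnatr_eq0. Qed.

(** Metric compatibility of the connection. In the curvature it moves the outer [nabla] to the other
    slot, so that only products of first-order terms remain. *)
Lemma nabla_skew x y z : ip (nabla x y) z = - ip (nabla x z) y.
Proof.
rewrite !nablaE (lieC x z) (lieC y x) (lieC y z) !dotNl; ring.
Qed.

Hypothesis e_geodesic : forall x i, ip (lie x (e i)) (e i) = 0.

(* [e_geodesic] gives [nabla (e i) (e i) = 0]; the last sum is the trace of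
   [ad x \o ad y]. *)
Lemma dot_ricci x y :
  ip (\sum_i curvature nabla x (e i) (e i)) y =
  4^-1 * (\sum_i \sum_j ip (lie (e i) (e j)) x * ip (lie (e i) (e j)) y)
  - 2^-1 * (\sum_i ip (lie x (e i)) (lie y (e i)))
  - 2^-1 * (\sum_i ip (lie x (lie y (e i))) (e i)).
Proof.
have nabla_ee i : nabla (e i) (e i) = 0.
  apply: (dot_inj (ip := ip)) => z.
  by rewrite nablaE liexx !e_geodesic !dot0l !addr0 mulr0.
have nabla_0 z : nabla z 0 = 0.
  apply: (dot_inj (ip := ip)) => t.
  by rewrite nablaE !lie0r !dot0l dot0r !addr0 mulr0.
(* [A] and [B] are the matrices of [ad x] and [ad y] in the frame; [S] and [T] pair the brackets of
   frame vectors with [x] and [y]. The Ricci form is quadratic in these. *)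
pose A i j := ip (lie x (e i)) (e j); pose B i j := ip (lie y (e i)) (e j).
pose S i j := ip (lie (e i) (e j)) x; pose T i j := ip (lie (e i) (e j)) y.
have curvE i : ip (curvature nabla x (e i) (e i)) y =
    \sum_j (4^-1 * ((A i j - A j i - S i j) * (- B i j - T i j - B j i)))
    - 2^-1 * \sum_j A i j * (- T i j + B j i + B i j).
  rewrite /curvature nabla_ee nabla_0 add0r dotDl !dotNl.
  rewrite -nabla_skew parseval; congr (_ - _).
    apply: eq_bigr => j _.
    rewrite !nablaE (lieC (e j) x) (lieC (e j) (e i)) (lieC (e i) y).
    rewrite (lieC (e j) y) !dotNl.
    by rewrite /A /B /S /T; field.
  rewrite nablaE (lieC y (lie x _)) dotNl.
  rewrite !(dot_lie_expl (lie x (e i))) (dotC ip (lie y _)) parseval.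
  rewrite -sumrN -!big_split /=; congr (_ * _); apply: eq_bigr => j _.
  by rewrite (lieC (e j) y) dotNl (lieC (e j) (e i)) dotNl -/(B _ _); ring.
rewrite dot_suml (eq_bigr _ (fun i _ => curvE i)).
rewrite [X in _ = _ - _ * X - _](eq_bigr _ (fun i _ => parseval _ _)).
have -> : \sum_i ip (lie x (lie y (e i))) (e i) = \sum_i \sum_j A i j * B j i.
  rewrite exchange_big; apply: eq_bigr => i _.
  rewrite lieC dotNl dot_lie_expl -sumrN; apply: eq_bigr => j _.
  by rewrite (lieC (e j)) dotNl mulrN opprK mulrC.
(* [U] is the termwise difference between the curvature sum and the claimed formula. It is
   antisymmetric in [i] and [j], so its double sum vanishes. *)
pose U i j := 4^-1 * ((A j i - A i j + S i j) * (B i j + B j i)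
                      + (A j i + A i j) * T i j).
have UC i j : U j i = - U i j.
  have SC : S j i = - S i j by rewrite /S lieC dotNl.
  have TC : T j i = - T i j by rewrite /T lieC dotNl.
  by rewrite /U SC TC; ring.
have U0 : \sum_i \sum_j U i j = 0.
  apply/eqP; rewrite -eqNr eq_sym; apply/eqP.
  rewrite [LHS]exchange_big -sumrN; apply: eq_bigr => i _.
  by rewrite -sumrN; apply: eq_bigr.
transitivity (
  4^-1 * (\sum_i \sum_j S i j * T i j) - 2^-1 * (\sum_i \sum_j A i j * B i j)
  - 2^-1 * (\sum_i \sum_j A i j * B j i) + \sum_i \sum_j U i j); last first.
  by rewrite U0 addr0.
rewrite !mulr_sumr -!sumrB -big_split; apply: eq_bigr => i _ /=.
rewrite !mulr_sumr -!sumrB -big_split; apply: eq_bigr => j _ /=.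
by rewrite /U -/(A i j) -/(B i j) -/(S i j) -/(T i j); field.
Qed.

End RicciFormula.

(** * Endpoints, inner vertices and concatenation *)

Section Paths.
Variable Q : finQuiver.
Implicit Types s t : seq (arrow Q).

(** The [option] supplies a default [None] for [head] and [last], never reached on a path since
    paths are nonempty. *)
Definition sources s : seq (option (vertex Q)) := [seq Some (src a) | a <- s].

Definition path_src s := head None (sources s).
Definition path_tgt s := last None [seq Some (tgt a) | a <- s].
(** In a path, the inner vertices are the sources of all arrows but the first. *)
Definition inner s := behead (sources s).

Lemma qpath_neq0 (p : qpath Q) : arrows p != [::].
Proof. by case/andP: (qpathP p). Qed.

Lemma inner_cat s t : s != [::] -> t != [::] ->
  inner (s ++ t) = inner s ++ path_src t :: inner t.
Proof.
by case: s t => [|a s] [|b t] // _ _; rewrite /inner /sources map_cat.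
Qed.

Lemma path_src_cat s t : s != [::] -> path_src (s ++ t) = path_src s.
Proof. by case: s. Qed.

Lemma path_tgt_cat s t : t != [::] -> path_tgt (s ++ t) = path_tgt t.
Proof. by case: t => // b t _; rewrite /path_tgt map_cat last_cat. Qed.

Lemma is_path_cat s t : s != [::] -> t != [::] ->
  is_path (s ++ t) = [&& is_path s, is_path t & path_tgt s == path_src t].
Proof.
case: s t => [|a s] [|b t] // _ _; rewrite /is_path /= cat_path /=.
have -> : path_tgt (a :: s) = Some (tgt (last a s)).
  by rewrite /path_tgt /= last_map.
by congr (_ && _); rewrite andbC.
Qed.

Lemma qpath_cat (p q : qpath Q) :
  is_path (p ++ q) = (path_tgt p == path_src q).
Proof. by rewrite is_path_cat ?qpath_neq0 // !qpathP. Qed.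

End Paths.

(** * Combinatorics of acyclic paths, weights and structure constants *)

Section AcyclicPaths.
Variable Q : acyclicQuiver.
Implicit Types p q r s u : qpath Q.

(** Otherwise the first arrow of [p] would stand at the head of [u] and again after the nonempty
    [r], but a path in an acyclic quiver has no repeated arrow. *)
Lemma cat_crossF p r s u : r ++ p = u -> p ++ s <> u.
Proof.
move=> rp ps; have := is_path_uniq (qpathP u); rewrite -{1}rp.
have : r ++ p = p ++ s by rewrite rp ps.
have := qpath_neq0 p; have := qpath_neq0 r.
case: (arrows p) => // a p'; case: (arrows r) => // b r' _ _ /= [-> _].
by rewrite mem_cat in_cons eqxx orbT.
Qed.

(** If both products were paths, so would be [p ++ q ++ p], which repeats the arrows of [p]. *)
Lemma cat_commF p q r s : p ++ q = r -> q ++ p <> s.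
Proof.
move=> pq qp.
have /is_path_uniq : is_path ((p ++ q) ++ p).
  rewrite is_path_cat ?qpath_neq0 ?pq ?qpath_neq0 ?qpathP //=.
  rewrite -pq path_tgt_cat ?qpath_neq0 // -qpath_cat qp; exact: qpathP.
rewrite -catA; have := qpath_neq0 p; case: (arrows p) => // a p' _ /=.
by rewrite !mem_cat in_cons eqxx !orbT.
Qed.

Definition outdeg v := #|[pred p : qpath Q | path_src p == v]|.
Definition indeg v := #|[pred p : qpath Q | path_tgt p == v]|.

Variable R : realType.

Definition vweight v : R := 2 / (indeg v + outdeg v).+1%:R.

Definition weight (p : qpath Q) : R := \prod_(v <- inner p) vweight v.

Lemma vweight_gt0 v : 0 < vweight v.
Proof. by rewrite divr_gt0 ?ltr0n. Qed.

Lemma weight_gt0 p : 0 < weight p.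
Proof. by apply: prodr_gt0 => v _; apply: vweight_gt0. Qed.

Lemma weight_neq0 p : weight p != 0.
Proof. by rewrite gt_eqF ?weight_gt0. Qed.

Lemma weight_cat p q r : p ++ q = r ->
  weight r = weight p * vweight (path_src q) * weight q.
Proof.
move=> e; rewrite /weight -e inner_cat ?qpath_neq0 // big_cat big_cons.
exact: mulrA.
Qed.

(** The structure constants of [nQ] in the basis of paths. *)
Definition lie_coef p q r : R := (p ++ q == r)%:R - (q ++ p == r)%:R.

(** By [cat_commF] at most one of the two concatenations is a path, so the bracket has at most one
    nonzero coefficient and the cross terms of its square vanish. This makes the first sum in the
    Ricci form diagonal. *)
Lemma lie_coef_mulr p q r s :
  lie_coef p q r * lie_coef p q s =
  (r == s)%:R * ((p ++ q == r)%:R + (q ++ p == r)%:R).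
Proof.
rewrite /lie_coef; have [<-|rs] := eqVneq r s.
  case: eqP => pq; case: eqP => qp; last 3 first.
  - by rewrite subr0 addr0 !mulr1.
  - by rewrite sub0r add0r mulrNN !mulr1.
  - by rewrite subr0 addr0 !mulr0.
  by case: (cat_commF pq qp).
rewrite mul0r; case: eqP => pq; case: (p ++ q =P s) => ps.
- by case/eqP: rs; apply: val_inj; rewrite /= -pq.
- case: (q ++ p =P s) => qs; first by case: (cat_commF pq qs).
  by rewrite subrr mulr0.
- case: eqP => qr; first by case: (cat_commF ps qr).
  by rewrite subrr mul0r.
case: eqP => qr; case: eqP => qs; rewrite ?(subr0, mul0r, mulr0) //.
by case/eqP: rs; apply: val_inj; rewrite /= -qr.
Qed.

(** Cancellation recovers a factor from [u] and [p] when [p] stands on the same side in both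
    products; [cat_crossF] excludes opposite sides. This makes the second sum in the Ricci form
    diagonal. *)
Lemma lie_coef_mull p r s u :
  lie_coef r p u * lie_coef s p u =
  (r == s)%:R * ((r ++ p == u)%:R + (p ++ r == u)%:R).
Proof.
rewrite /lie_coef; have [<-|rs] := eqVneq r s.
  case: eqP => pq; case: eqP => qp; last 3 first.
  - by rewrite subr0 addr0 !mulr1.
  - by rewrite sub0r add0r mulrNN !mulr1.
  - by rewrite subr0 addr0 !mulr0.
  by case: (cat_crossF pq qp).
have inj_r x : x ++ r <> x ++ s.
  move/(congr1 (drop (size x))); rewrite !drop_size_cat // => /val_inj /eqP.
  by rewrite (negPf rs).
have inj_l x : r ++ x <> s ++ x.
  move/(congr1 rev); rewrite !rev_cat => /(congr1 (drop (size (rev x)))).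
  rewrite !drop_size_cat // => /(congr1 rev); rewrite !revK => /val_inj /eqP.
  by rewrite (negPf rs).
rewrite mul0r; case: eqP => rp; case: (s ++ p =P u) => sp.
- by case: (inj_l p); rewrite rp.
- case: (p ++ s =P u) => ps; first by case: (cat_crossF rp ps).
  by rewrite subrr mulr0.
- case: eqP => pr; first by case: (cat_crossF sp pr).
  by rewrite subrr mul0r.
case: eqP => pr; case: eqP => ps; rewrite ?(subr0, mul0r, mulr0) //.
by case: (inj_r p); rewrite pr.
Qed.

Lemma sum_weight_cat p q :
  \sum_(u : qpath Q) (p ++ q == u)%:R * weight u =
  (path_tgt p == path_src q)%:R * (weight p * vweight (path_src q) * weight q).
Proof.
rewrite -qpath_cat; case: (boolP (is_path _)) => [pq|npq].
  rewrite (bigD1 (QPath pq)) //= eqxx big1 => [|u /eqP u_pq]; last first.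
    by case: eqP => [e|]; rewrite ?mul0r //; case: u_pq; apply: val_inj.
  by rewrite addr0 (@weight_cat p q (QPath pq)).
rewrite mul0r big1 // => u _; case: eqP => [e|]; rewrite ?mul0r //.
by case/negP: npq; rewrite e qpathP.
Qed.

(** Splitting [r] into two paths amounts to cutting it at an inner vertex, which is the source of
    the second factor. *)
Lemma sum_splits r (F : option (vertex Q) -> R) :
  \sum_(p : qpath Q) \sum_(q : qpath Q) (p ++ q == r)%:R * F (path_src q) =
  \sum_(v <- inner r) F v.
Proof.
have size_inner : size (inner r) = (size r).-1 by rewrite size_behead size_map.
have r_lt (i : 'I_(size r).-1) : (i.+1 < size r)%N.
  by case: i => i /=; case: (size r).
have tP (i : 'I_(size r).-1) : is_path (take i.+1 r).
  have /andP[r0 r_sorted] := qpathP r; rewrite /is_path take_sorted // andbT.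
  by rewrite -size_eq0 size_takel // ltnW.
have dP (i : 'I_(size r).-1) : is_path (drop i.+1 r).
  have /andP[r0 r_sorted] := qpathP r; rewrite /is_path drop_sorted // andbT.
  by rewrite -size_eq0 size_drop subn_eq0 -ltnNge.
pose split i := (QPath (tP i), QPath (dP i)).
(* Partial inverse of [split]: cut number [i] comes after [i.+1] arrows, because the first factor is
   nonempty. *)
pose pos (u : qpath Q * qpath Q) : option 'I_(size r).-1 := insub (size u.1).-1.
rewrite pair_bigA /= (eq_bigr (fun u : qpath Q * qpath Q =>
    if u.1 ++ u.2 == r then F (path_src u.2) else 0)); last first.
  by move=> u _; case: eqP; rewrite ?mul1r ?mul0r.
rewrite -big_mkcond (reindex_omap split pos) /=; last first.
  move=> [p q] /= /eqP pq; rewrite /pos /=.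
  have [p0 q0] := (qpath_neq0 p, qpath_neq0 q).
  have p_lt : ((size p).-1 < (size r).-1)%N.
    rewrite -pq size_cat; move: p0 q0; case: (arrows p) => // a p' _.
    by case: (arrows q) => // b q' _; rewrite /= addnS ltnS leq_addr.
  rewrite insubT /=; set i := Sub _ _.
  have sp : i.+1 = size p by move: p0; rewrite /=; case: (arrows p).
  congr Some; congr pair; apply: val_inj => /=.
    by rewrite sp -pq take_size_cat.
  by rewrite sp -pq drop_size_cat.
rewrite (big_nth None) big_mkord size_inner.
apply: eq_big => [i|i _].
  rewrite cat_take_drop eqxx /pos /= size_takel ?(ltnW (r_lt i)) //=.
  by rewrite insubT //= => lt_i; apply/eqP; congr Some; apply: val_inj.
by rewrite nth_behead /path_src /sources map_drop -nth0 nth_drop addn0.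
Qed.

End AcyclicPaths.

(** * The weighted inner product and its Ricci form *)

Section PathMetric.
Variables (Q : acyclicQuiver) (R : realType).
Implicit Types (x y z : nQ Q R) (p q r s u : qpath Q).

Let w p : R := weight R p.

Definition path_dot x y : R := \sum_p w p * (x p * y p).

Lemma path_dot_bilinear : bilinear_for
  (GRing.Scale.Law.clone R R *%R _) (GRing.Scale.Law.clone R R (idfun \; *%R) _)
  path_dot.
Proof.
split=> [y|x] a u v; rewrite /path_dot /= mulr_sumr -big_split; apply: eq_bigr;
  by move=> p _; rewrite !ffunE /= /GRing.scale /=; ring.
Qed.

HB.instance Definition _ := bilinear_isBilinear.Build R (nQ Q R) (nQ Q R) R
  _ _ path_dot path_dot_bilinear.

Lemma path_dot_hermitian x y : path_dot x y = (-1) ^+ false * path_dot y x.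
Proof. by rewrite mul1r; apply: eq_bigr => p _; rewrite (mulrC (x p)). Qed.

HB.instance Definition _ := isHermitianSesquilinear.Build R (nQ Q R) false idfun
  path_dot path_dot_hermitian.

Lemma path_dot_gt0 x : x != 0 -> 0 < path_dot x x.
Proof.
move=> x0; have [p xp] : exists p, x p != 0.
  apply/existsP; apply: contraR x0; rewrite negb_exists => /forallP xN.
  by apply/eqP/ffunP => p; rewrite ffunE; apply/eqP/negPn.
rewrite /path_dot (bigD1 p) //= ltr_pwDl //; last first.
  apply: sumr_ge0 => q _; rewrite mulr_ge0 ?(ltW (weight_gt0 _ _)) //.
  exact: (sqr_ge0 (x q : R)).
rewrite mulr_gt0 ?weight_gt0 //.
by have := exprn_even_gt0 (x p : R) (isT : ~~ odd 2); rewrite xp expr2.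
Qed.

HB.instance Definition _ := isDotProduct.Build R (nQ Q R)
  path_dot path_dot_gt0.

Let ip : {dot nQ Q R for idfun} := path_dot.

Lemma dot_path_vec x p : ip x (path_vec R p) = w p * x p.
Proof.
rewrite /ip /= /path_dot (bigD1 p) //= ffunE eqxx mulr1 big1 ?addr0 // => q qp.
by rewrite ffunE (negPf qp) !mulr0.
Qed.

Lemma path_mulE x y r :
  path_mul x y r =
  \sum_(p : qpath Q) \sum_(q : qpath Q) (p ++ q == r)%:R * (x p * y q).
Proof.
rewrite /path_mul sum_ffunE; apply: eq_bigr => p _.
rewrite sum_ffunE; apply: eq_bigr => q _; rewrite ffunE [RHS]mulrC.
congr (_ * _); rewrite /concat.
case: (insubP (qpath Q) (val p ++ val q)) => [s _ es|npq].
  by rewrite ffunE -es eq_sym.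
rewrite ffunE; case: eqP => // pq; case/negP: npq; rewrite /= pq; exact: qpathP.
Qed.

Lemma path_vec_mulE p q r :
  path_mul (path_vec R p) (path_vec R q) r = (p ++ q == r)%:R.
Proof.
rewrite path_mulE (bigD1 p) //= (bigD1 q) //= !ffunE !eqxx !mulr1.
rewrite big1 => [|s sq]; last by rewrite ffunE (negPf sq) !mulr0.
rewrite big1 ?addr0 // => s sp; rewrite big1 // => u _.
by rewrite ffunE (negPf sp) mul0r mulr0.
Qed.

Lemma path_vec_lieE p q r :
  lie (path_vec R p) (path_vec R q) r = lie_coef R p q r.
Proof. by rewrite [LHS]ffunE ffunE !path_vec_mulE. Qed.

Definition unit_vec p : nQ Q R := (Num.sqrt (w p))^-1 *: path_vec R p.

Lemma unit_vec_exp x : x = \sum_p ip x (unit_vec p) *: unit_vec p.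
Proof.
rewrite {1}(nQ_path_vec x); apply: eq_bigr => p _.
rewrite /unit_vec dotZr dot_path_vec scalerA; congr (_ *: _).
rewrite mulrAC -invfM -expr2 sqr_sqrtr ?(ltW (weight_gt0 _ _)) //.
by rewrite mulrA mulVf ?mul1r ?weight_neq0.
Qed.

Lemma unit_vec_sqr p : (Num.sqrt (w p))^-1 * (Num.sqrt (w p))^-1 = (w p)^-1.
Proof. by rewrite -invfM -expr2 sqr_sqrtr // ltW ?weight_gt0. Qed.

Lemma unit_vec_dot p q : ip (unit_vec p) (unit_vec q) = (p == q)%:R.
Proof.
rewrite /unit_vec dotZl dotZr dot_path_vec ffunE.
have [->|] := eqVneq p q; last by rewrite !mulr0.
by rewrite mulr1 mulrA unit_vec_sqr mulVf ?weight_neq0.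
Qed.

(* The coefficient at a path only involves shorter factors. *)
Lemma lie_supp n x y :
  (forall p, (size p <= n)%N -> y p = 0) ->
  forall p, (size p <= n.+1)%N -> lie x y p = 0.
Proof.
move=> y0 p p_n; rewrite [LHS]ffunE ffunE !path_mulE.
have short q r : q ++ r = p -> (size q <= n)%N /\ (size r <= n)%N.
  move=> qr; move: p_n; rewrite -qr size_cat.
  case: (arrows q) (qpath_neq0 q) => // a l _.
  case: (arrows r) (qpath_neq0 r) => // b l' _.
  rewrite /= addSn addnS ltnS => l_n; split; apply: leq_trans l_n.
    by rewrite ltnS leq_addr.
  by rewrite ltnS leq_addl.
rewrite big1 ?big1 ?subrr // => q _; rewrite big1 // => r _.
  by case: eqP => [/short[/y0-> _]|]; rewrite ?mul0r ?mulr0.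
by case: eqP => [/short[_ /y0->]|]; rewrite ?mul0r ?mulr0.
Qed.

(** Bracketing lengthens paths, so the path [p] itself cannot occur in a bracket with [p]. This
    provides the hypothesis [e_geodesic]. *)
Lemma unit_vec_geodesic x p : ip (lie x (unit_vec p)) (unit_vec p) = 0.
Proof.
rewrite /unit_vec dotZr dot_path_vec lieZr ffunE.
have -> : lie x (path_vec R p) p = 0; last by rewrite scaler0 !mulr0.
case: p => -[//|a l] pP; apply: (@lie_supp (size l)) => //= q q_l.
by rewrite ffunE; case: eqP q_l => [->|//]; rewrite /= ltnn.
Qed.

(** The Killing form of a nilpotent Lie algebra vanishes; here each diagonal entry of the trace is
    already zero, again by length. *)
Lemma unit_vec_killing x y p : ip (lie x (lie y (unit_vec p))) (unit_vec p) = 0.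
Proof.
rewrite /unit_vec dotZr dot_path_vec !lieZr ffunE.
have -> : lie x (lie y (path_vec R p)) p = 0; last by rewrite scaler0 !mulr0.
case: p => -[//|a l] pP; apply: (@lie_supp (size l).+1) => [q q_l|//=].
apply: (@lie_supp (size l)) => // {q_l} q q_l.
by rewrite ffunE; case: eqP q_l => [->|//]; rewrite /= ltnn.
Qed.

(** For [r = s], a splitting of [r] into [a] and [b] at [v] contributes [w r ^+ 2 / (w a * w b)],
    which is [w r * vweight R v] by [weight_cat]. The factor 2 counts both orders of the pair. *)
Lemma dot_lie_unit r s :
  \sum_p \sum_q ip (lie (unit_vec p) (unit_vec q)) (path_vec R r)
                * ip (lie (unit_vec p) (unit_vec q)) (path_vec R s) =
  (r == s)%:R * (2 * w r * \sum_(v <- inner r) vweight R v).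
Proof.
have E p q : ip (lie (unit_vec p) (unit_vec q)) (path_vec R r)
             * ip (lie (unit_vec p) (unit_vec q)) (path_vec R s) =
    (r == s)%:R * (w r * ((p ++ q == r)%:R * vweight R (path_src q)
                          + (q ++ p == r)%:R * vweight R (path_src p))).
  rewrite !lieZl !lieZr !dotZl !dot_path_vec !path_vec_lieE.
  rewrite [LHS](_ : _ = ((Num.sqrt (w p))^-1 * (Num.sqrt (w p))^-1)
    * ((Num.sqrt (w q))^-1 * (Num.sqrt (w q))^-1) * (w r * w s)
    * (lie_coef R p q r * lie_coef R p q s)); last by ring.
  rewrite !unit_vec_sqr lie_coef_mulr.
  have [<-|] := eqVneq r s; last by rewrite !mul0r mulr0.
  rewrite !mul1r.
  have wr (a b : qpath Q) : (a ++ b == r)%:R * w r =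
      (a ++ b == r)%:R * (w a * vweight R (path_src b) * w b).
    by case: eqP => [/weight_cat <-|]; rewrite ?mul0r.
  have wp := weight_neq0 R p; have wq := weight_neq0 R q.
  transitivity ((w p)^-1 * (w q)^-1 * w r * ((p ++ q == r)%:R * w r
     + (q ++ p == r)%:R * w r)); first by ring.
  by rewrite !wr /w; field; rewrite wp wq.
transitivity ((r == s)%:R * (w r *
  (\sum_(p : qpath Q) \sum_(q : qpath Q)
     (p ++ q == r)%:R * vweight R (path_src q)
   + \sum_(p : qpath Q) \sum_(q : qpath Q)
     (q ++ p == r)%:R * vweight R (path_src p)))).
  rewrite -big_split !mulr_sumr; apply: eq_bigr => p _.
  by rewrite -big_split !mulr_sumr; apply: eq_bigr => q _.
rewrite [X in _ + X]exchange_big sum_splits; ring.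
Qed.

(** For [r = s], each [p] that can follow [r] contributes [w (r ++ p) / w p], that is, [w r] times
    the weight of the joining vertex, and there are [outdeg] many; the paths preceding [r] are
    counted by [indeg] likewise. *)
Lemma dot_lie_path_unit r s :
  \sum_p ip (lie (path_vec R r) (unit_vec p))
            (lie (path_vec R s) (unit_vec p)) =
  (r == s)%:R * (w r * (vweight R (path_tgt r) * (outdeg (path_tgt r))%:R
                        + vweight R (path_src r) * (indeg (path_src r))%:R)).
Proof.
have E p : ip (lie (path_vec R r) (unit_vec p))
              (lie (path_vec R s) (unit_vec p)) =
    (r == s)%:R *
    (w r * (vweight R (path_tgt r) * (path_src p == path_tgt r)%:R
            + vweight R (path_src r) * (path_tgt p == path_src r)%:R)).
  rewrite !lieZr dotZl dotZr mulrA unit_vec_sqr /ip /= /path_dot.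
  transitivity ((w p)^-1 * ((r == s)%:R *
    (\sum_(u : qpath Q) (r ++ p == u)%:R * w u
     + \sum_(u : qpath Q) (p ++ r == u)%:R * w u))).
    congr (_ * _); rewrite -big_split mulr_sumr; apply: eq_bigr => u _.
    rewrite !path_vec_lieE lie_coef_mull /=; ring.
  rewrite !sum_weight_cat [path_tgt r == _]eq_sym.
  have wp := weight_neq0 R p.
  have [->|_] := eqVneq (path_src p) (path_tgt r); rewrite /w /=; by field.
rewrite (eq_bigr _ (fun p _ => E p)) -!mulr_sumr big_split -!mulr_sumr /=.
have card_sum (P : pred (qpath Q)) : \sum_p (P p)%:R = #|P|%:R :> R.
  rewrite -sum1_card natr_sum [in RHS]big_mkcond; apply: eq_bigr => p _.
  by rewrite unfold_in; case: (P p).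
rewrite (card_sum (fun p => path_src p == _)).
by rewrite (card_sum (fun p => path_tgt p == _)).
Qed.

(** * The diagonal derivation and the soliton equation *)

Definition soliton_eig p : R :=
  1 + 2^-1 * (\sum_(v <- inner p) vweight R v
              - vweight R (path_tgt p) * (outdeg (path_tgt p))%:R
              - vweight R (path_src p) * (indeg (path_src p))%:R).

(* [vweight v * (1 + indeg v + outdeg v) = 2] is exactly this additivity. *)
Lemma soliton_eig_cat p q r : p ++ q = r ->
  soliton_eig r = soliton_eig p + soliton_eig q.
Proof.
move=> pq; have [p0 q0] := (qpath_neq0 p, qpath_neq0 q).
have pqv : path_tgt p = path_src q.
  by apply/eqP; rewrite -qpath_cat pq qpathP.
rewrite /soliton_eig -pq inner_cat // path_src_cat // path_tgt_cat // pqv.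
rewrite big_cat big_cons /=; set v := path_src q.
have : vweight R v * (1 + (indeg v)%:R + (outdeg v)%:R) = 2.
  by rewrite -addrA -natrD nat1r /vweight mulfVK ?pnatr_eq0.
set k := vweight R v => k_v.
(* Rewriting only the weight of the joining vertex, new among the inner vertices of [r]: half of the
   2 is the second constant [1] on the right, and the degree terms are the endpoint terms of [p] and
   [q] at [v]. *)
have kE : k = 2 - k * (indeg v)%:R - k * (outdeg v)%:R by rewrite -k_v; ring.
by rewrite {1}kE; field.
Qed.

Definition soliton_der x : nQ Q R := [ffun p => soliton_eig p * x p].

Lemma soliton_der_linear : linear soliton_der.
Proof.
by move=> a x y; apply/ffunP => p; rewrite !ffunE /GRing.scale /=; ring.
Qed.

HB.instance Definition _ := GRing.isLinear.Build R (nQ Q R) (nQ Q R) *:%R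
  soliton_der soliton_der_linear.

(** Additivity of the eigenvalues gives the Leibniz rule already for the associative product, hence
    for its commutator. *)
Lemma soliton_der_mul x y r :
  soliton_der (path_mul x y) r =
  path_mul (soliton_der x) y r + path_mul x (soliton_der y) r.
Proof.
rewrite ffunE !path_mulE mulr_sumr -big_split; apply: eq_bigr => p _.
rewrite mulr_sumr -big_split; apply: eq_bigr => q _; rewrite !ffunE /=.
case: eqP => [/soliton_eig_cat ->|_]; last by rewrite !mul0r mulr0 addr0.
by rewrite !mul1r; ring.
Qed.

Lemma soliton_der_derivation : derivation (linfun soliton_der).
Proof.
move=> x y; rewrite !lfunE /=; apply/ffunP => r.
rewrite [LHS]ffunE [lie x y r]ffunE ffunE.
have := soliton_der_mul x y r; have := soliton_der_mul y x r.
rewrite ![soliton_der (path_mul _ _) _]ffunE => e1 e2.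
rewrite mulrDr mulrN e2 e1 !ffunE; ring.
Qed.

Lemma nQ_linear_ext (f h : nQ Q R -> R) :
  (forall c x y, f (c *: x + y) = c * f x + f y) ->
  (forall c x y, h (c *: x + y) = c * h x + h y) ->
  (forall p, f (path_vec R p) = h (path_vec R p)) -> f =1 h.
Proof.
move=> fl hl fh x.
have f0 : f 0 = 0 by have := fl (-1) 0 0; rewrite scaler0 addr0 mulN1r addNr.
have h0 : h 0 = 0 by have := hl (-1) 0 0; rewrite scaler0 addr0 mulN1r addNr.
rewrite (nQ_path_vec x); elim/big_rec: _ => [|p y _ fhy].
  by rewrite f0 h0.
by rewrite fl hl fh fhy.
Qed.

(** Both sides are bilinear, so it suffices to compare them on pairs of paths, where both are
    diagonal. *)
Lemma ricci_path x y :
  ip (\sum_p curvature (koszul ip unit_vec) x (unit_vec p) (unit_vec p)) y =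
  ip (-1 *: x + soliton_der x) y.
Proof.
rewrite (dot_ricci unit_vec_exp (koszulP unit_vec_exp) unit_vec_geodesic).
rewrite [X in _ - _ * X]big1 => [|p _]; last exact: unit_vec_killing.
rewrite mulr0 subr0.
pose T x y := \sum_p \sum_q ip (lie (unit_vec p) (unit_vec q)) x
                * ip (lie (unit_vec p) (unit_vec q)) y.
pose A x y := \sum_p ip (lie x (unit_vec p)) (lie y (unit_vec p)).
pose F x y := 4^-1 * T x y - 2^-1 * A x y.
rewrite -[LHS]/(F x y).
(* By symmetry, linearity of [F] needs checking in the first argument only. *)
have FC a b : F a b = F b a.
  rewrite /F /T /A; congr (_ * _ - _ * _).
    by apply: eq_bigr => p _; apply: eq_bigr => q _; rewrite mulrC.
  by apply: eq_bigr => p _; rewrite dotC.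
have Fl b c (u v : nQ Q R) : F (c *: u + v) b = c * F u b + F v b.
  have Tl : T (c *: u + v) b = c * T u b + T v b.
    rewrite /T mulr_sumr -big_split; apply: eq_bigr => p _ /=.
    rewrite mulr_sumr -big_split; apply: eq_bigr => q _ /=.
    by rewrite ![ip (lie (unit_vec p) _) _]dotC dotDl dotZl; ring.
  have Al : A (c *: u + v) b = c * A u b + A v b.
    rewrite /A mulr_sumr -big_split; apply: eq_bigr => p _ /=.
    by rewrite lieDl lieZl dotDl dotZl.
  by rewrite /F Tl Al; ring.
apply: (nQ_linear_ext (f := F^~ y)
                      (h := fun x => ip (-1 *: x + soliton_der x) y)) => //.
  by move=> c u v; rewrite soliton_der_linear !(dotDl, dotZl); ring.
move=> r; apply: (nQ_linear_ext (f := F _) (h := ip _)) => [c u v|c u v|s].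
- by rewrite !(FC (path_vec R r)) Fl.
- by rewrite dotC dotDl dotZl !(dotC ip (_ *: _ + _)).
rewrite /F /T /A dot_lie_unit dot_lie_path_unit dot_path_vec !ffunE.
rewrite /soliton_eig /GRing.scale /= (eq_sym s).
have [<-|_] := eqVneq r s; last by rewrite !mul0r !mulr0 addr0 mulr0 subr0.
by rewrite !mul1r !mulr1; field.
Qed.

(** * Orthogonal and orthonormal bases of rescaled paths *)

Lemma dim_nQ : \dim {: nQ Q R} = #|{: qpath Q}|.
Proof. by rewrite dimvf /dim /= muln1. Qed.

(** Covers the paths themselves, with [c = 1], and the unit vectors. The family spans and has as
    many members as the dimension. *)
Lemma scaled_path_basis (c : qpath Q -> R) : (forall p, c p != 0) ->
  basis_of fullv [seq c p *: path_vec R p | p : qpath Q] &&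
  pairwise_orthogonal ip [seq c p *: path_vec R p | p : qpath Q].
Proof.
move=> c0; have ipE p q : ip (c p *: path_vec R p) (c q *: path_vec R q) =
    (p == q)%:R * (c p ^+ 2 * w p).
  rewrite dotZl dotZr dot_path_vec ffunE.
  by have [->|] := eqVneq p q; rewrite ?mul0r ?mulr0 //; ring.
apply/andP; split.
  rewrite basisEdim size_map -cardE dim_nQ leqnn andbT; apply/subvP => x _.
  rewrite (nQ_path_vec x) memv_suml // => p _.
  rewrite -(divfK (c0 p) (x p)) -scalerA memvZ // memv_span //.
  exact: image_f.
rewrite /pairwise_orthogonal; apply/andP; split.
  apply/negP => /imageP[p _ /esym e0]; have /eqP := ipE p p.
  rewrite e0 dot0l eqxx mul1r eq_sym mulf_eq0 expf_eq0 /= (negPf (c0 p)).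
  by rewrite (negPf (weight_neq0 R p)).
rewrite /image_mem; elim: (enum _) (enum_uniq {: qpath Q}) => //= p l IHl.
case/andP=> pl /IHl ->.
rewrite !andbT; apply/allP => _ /mapP[q ql ->] /=; rewrite ipE.
by case: (eqVneq p q) pl => [->|]; rewrite ?ql // mul0r.
Qed.

Lemma path_basis_orthogonal : orthogonal_basis ip (path_basis Q R).
Proof.
rewrite /orthogonal_basis /path_basis.
rewrite (eq_image (g := fun p => 1 *: path_vec R p) (frefl _)) => [|p].
  exact: scaled_path_basis (fun _ => oner_neq0 R).
by rewrite scale1r.
Qed.

Lemma unit_basis_orthonormal :
  orthonormal_basis ip [seq unit_vec p | p : qpath Q].
Proof.
have c0 p : (Num.sqrt (w p))^-1 != 0.
  by rewrite invr_eq0 sqrtr_eq0 -ltNge weight_gt0.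
have /andP[eB /andP[_ eO]] := scaled_path_basis c0.
rewrite /orthonormal_basis eB /orthonormal eO andbT.
apply/allP => _ /imageP[p _ ->].
by rewrite /= unit_vec_dot eqxx.
Qed.

Lemma path_dot_soliton : ricci_soliton_eq ip (-1) (linfun soliton_der).
Proof.
split; first exact: soliton_der_derivation.
exists (koszul ip unit_vec); first exact: koszulP unit_vec_exp.
exists [seq unit_vec p | p : qpath Q]; first exact: unit_basis_orthonormal.
move=> x; rewrite lfunE big_image; apply: (dot_inj (ip := ip)) => y.
by rewrite -ricci_path.
Qed.

(** * Invariance under quiver automorphisms *)

Section Automorphism.
Variables (f : {perm arrow Q}) (fA : f \in quiver_aut Q).

Lemma aut_path_bij : bijective (aut_path fA).
Proof.
apply: injF_bij => p q /(congr1 (fun r : qpath Q => arrows r)) /= /inj_map.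
by move=> /(_ (@perm_inj _ f)) /val_inj.
Qed.

(** As [f] does not act on vertices, a vertex is named by an arrow [a] ending there; the statement
    then says that [f] preserves and reflects composability. *)
Lemma path_src_aut a p : (path_src p == Some (tgt a)) =
  (path_src (aut_path fA p) == Some (tgt (f a))).
Proof.
case: p => -[//|b l] bP; have [f1 f2] := quiver_autP f fA a b.
rewrite /path_src /=; apply/eqP/eqP => -[] /esym; first by move/f1->.
by move/f2->.
Qed.

Lemma path_tgt_aut b p : (path_tgt p == Some (src b)) =
  (path_tgt (aut_path fA p) == Some (src (f b))).
Proof.
case: p => -[//|a l] aP; have [f1 f2] := quiver_autP f fA (last a l) b.
rewrite /path_tgt /= !last_map; apply/eqP/eqP => -[]; first by move/f1->.
by move/f2->.
Qed.

(** The vertex is named in two ways: as [src b] to transport the paths ending there, as [tgt a] for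
    those starting there. Inner vertices of paths always admit both. *)
Lemma vweight_aut a b : tgt a = src b ->
  vweight R (Some (src (f b))) = vweight R (Some (src b)).
Proof.
move=> ab; have fab := (quiver_autP f fA a b).1 ab.
have f_inj := bij_inj aut_path_bij.
rewrite /vweight /indeg /outdeg -!sum1_card; congr (_ / (_ + _).+1%:R).
  rewrite [LHS](reindex_inj f_inj); apply: eq_bigl => p.
  by rewrite !inE -path_tgt_aut.
rewrite [LHS](reindex_inj f_inj); apply: eq_bigl => p.
by rewrite !inE -fab -ab -path_src_aut.
Qed.

Lemma weight_aut p : w (aut_path fA p) = w p.
Proof.
rewrite /w /weight /inner /=.
case: p => -[//|a l] /= /andP[_ /=].
rewrite /sources -!map_comp.
elim: l a => [|b l IHl] a; rewrite ?big_nil //= => /andP[/eqP ab bl].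
by rewrite !big_cons /= (vweight_aut ab) (IHl b).
Qed.

End Automorphism.

Lemma path_dot_aut : preserved_by_aut ip.
Proof.
move=> f fA x y; rewrite -[LHS]/(ip _ _) -[RHS]/(ip _ _) /aut_act.
rewrite {2}(nQ_path_vec x) {2}(nQ_path_vec y) !dot_suml; apply: eq_bigr => p _.
rewrite !dot_sumr; apply: eq_bigr => q _.
rewrite !dotZl !dotZr !dot_path_vec weight_aut !ffunE.
by rewrite (inj_eq (bij_inj (aut_path_bij fA))).
Qed.

End PathMetric.

Theorem theorem4p10 (R : realType) (Q : acyclicQuiver) :
  exists ip : {dot nQ Q R for idfun},
    [/\ exists D : 'End(nQ Q R), diagonal D /\ ricci_soliton_eq ip (-1) D,
        orthogonal_basis ip (path_basis Q R)
      & preserved_by_aut ip].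
Proof.
exists (@path_dot Q R); split; last exact: path_dot_aut.
  exists (linfun (@soliton_der Q R)); split; last exact: path_dot_soliton.
  exists (soliton_eig R) => p; rewrite lfunE; apply/ffunP => q; rewrite !ffunE.
  by have [->|_] := eqVneq q p; rewrite ?mulr0 ?scaler0.
exact: path_basis_orthogonal.
Qed.
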